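(* Let $\Gamma$ be a (possibly infinite) alphabet and let $S \subseteq \Gamma^*\times\Gamma^*$ be a confluent, weakly-terminating semi-Thue system such that the quotient monoid $G=\Gamma^*/S$ is a group. For each $a\in\Gamma$ fix a word $\widetilde a\in\Gamma^*$ with $a\widetilde a=1$ in $G$, and let $S^\circ=S\cup\{1\to a\widetilde a,\ 1\to\widetilde a a\mid a\in\Gamma\}$. Then: 1) Words $u,v\in\Gamma^*$ are conjugate in $G$ if and only if there is a (cyclic) word $t$ such that $u\overset{\circledast}{\Longrightarrow}_{S^\circ}t\overset{\circledast}{\Longleftarrow}_{S^\circ}v$. 2) $S^\circ$ is a C-extension of $S$.
   Context: A semi-Thue system is a set $S\subseteq\Gamma^*\times\Gamma^*$; its one-step relation is $u\Rightarrow_S v$ iff $u=p\ell q$, $v=prq$ for some $(\ell,r)\in S$. $\Rightarrow_S^{*}$ is the reflexive transitive closure; $\Gamma^*/S$ is the quotient of $\Gamma^*$ by the congruence generated by $S$. The empty word is denoted $1$. A relation $\Rightarrow$ on a set is confluent if $y\Leftarrow^* x\Rightarrow^* z$ implies $y\Rightarrow^* w\Leftarrow^* z$ for some $w$; $S$ is confluent if $\Rightarrow_S$ is. Cyclic words: $u\sim v$ means $u=rs$, $v=sr$ for some $r,s\in\Gamma^*$; the cyclic word of $w$ is its class $w_\sim$ under $\sim$. For a semi-Thue system $T$, $u_\sim\overset{\circ}{\Longrightarrow}_T v_\sim$ iff there are $u'\sim u$, $v'\sim v$ with $u'\Rightarrow_T v'$; $\overset{\circledast}{\Longrightarrow}_T$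 is the reflexive transitive closure of this relation on cyclic words and $\overset{\circledast}{\Longleftarrow}_T$ its converse. One writes $u$ in place of $u_\sim$. Weak termination: for $x,y\in\Gamma^*$ write $x>y$ if $x\Rightarrow_S^* pyq$ for some $p,q\in\Gamma^*$ with $pq\ne 1$. $S$ is weakly-terminating if there are no infinite chains $x_1>x_2>x_3>\cdots$. A semi-Thue system $T$ is a C-extension of $S$ if $S\subseteq T$, $\Gamma^*/S=\Gamma^*/T$ (the same congruence on $\Gamma^*$), and $\overset{\circ}{\Longrightarrow}_T$ is confluent on cyclic words. *)

(* Defs.v *)
From Stdlib Require Import List Relations Relations_2 Relations_3 RelationClasses.
From Stdlib Require Import FunctionalExtensionality PropExtensionality ProofIrrelevance.
Import ListNotations.

Set Implicit Arguments.

(** * Quotients by a relation, as types of classes *)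

Definition quotient {A : Type} (E : relation A) : Type :=
  {C : A -> Prop | exists a, C = E a}.

Definition class {A : Type} (E : relation A) (a : A) : quotient E :=
  exist _ (E a) (ex_intro _ a eq_refl).

Lemma class_surj {A : Type} (E : relation A) (x : quotient E) :
  exists a, x = class E a.
Proof.
  destruct x as [C [a Ha]]; subst C; exists a; reflexivity.
Qed.

Lemma class_eq {A : Type} (E : relation A) (HE : Equivalence E) (a b : A) :
  class E a = class E b <-> E a b.
Proof.
  split; intro H.
  - apply (f_equal (@proj1_sig _ _)) in H; simpl in H.
    rewrite H; reflexivity.
  - assert (HC : E a = E b).
    { apply functional_extensionality; intro c; apply propositional_extensionality.
      split; intro H1; [symmetry in H|]; etransitivity; eassumption. }
    apply subset_eq_compat; exact HC.
Qed.

(** * Monoids *)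

Record monoid : Type := Monoid {
  carrier :> Type;
  mul : carrier -> carrier -> carrier;
  one : carrier;
  mul_assoc : forall x y z, mul x (mul y z) = mul (mul x y) z;
  mul_one_l : forall x, mul one x = x;
  mul_one_r : forall x, mul x one = x
}.

Arguments mul {m} _ _.
Arguments one {m}.

Definition inverse_of {M : monoid} (x y : M) : Prop :=
  mul x y = one /\ mul y x = one.

Definition is_group (M : monoid) : Prop :=
  forall x : M, exists y : M, inverse_of x y.

Definition conjugate {M : monoid} (x y : M) : Prop :=
  exists g h : M, inverse_of g h /\ mul (mul h x) g = y.

(** * Semi-Thue systems *)

(** The pair [(l, r)] is a rule of [T] when [T l r] holds. *)
Definition semi_thue (Gamma : Type) : Type := relation (list Gamma).

Definition step {Gamma : Type} (T : semi_thue Gamma) : relation (list Gamma) :=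
  fun u v => exists p q l r,
    T l r /\ u = p ++ l ++ q /\ v = p ++ r ++ q.

Definition weakly_greater {Gamma : Type} (T : semi_thue Gamma) :
    relation (list Gamma) :=
  fun x y => exists p q, p ++ q <> [] /\ Rstar _ (step T) x (p ++ y ++ q).

Definition weakly_terminating {Gamma : Type} (T : semi_thue Gamma) : Prop :=
  ~ exists x : nat -> list Gamma, forall n, weakly_greater T (x n) (x (1 + n)).

Inductive congruence {Gamma : Type} (T : semi_thue Gamma) :
    relation (list Gamma) :=
| congruence_rule l r : T l r -> congruence T l r
| congruence_refl u : congruence T u u
| congruence_sym u v : congruence T u v -> congruence T v u
| congruence_trans u v w :
    congruence T u v -> congruence T v w -> congruence T u w
| congruence_app u u' v v' :
    congruence T u u' -> congruence T v v' -> congruence T (u ++ v) (u' ++ v').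

Lemma congruence_equiv {Gamma : Type} (T : semi_thue Gamma) :
  Equivalence (congruence T).
Proof.
  split; red; intros; eauto using congruence_refl, congruence_sym, congruence_trans.
Qed.

(** * The quotient monoid of a semi-Thue system *)

(** The product of two classes is the class of [u ++ v] for any
    representatives [u] and [v] ([quotient_mul_class]). *)
Definition quotient_mul {Gamma : Type} (T : semi_thue Gamma)
    (x y : quotient (congruence T)) : quotient (congruence T).
Proof.
  exists (fun w => exists u v,
    proj1_sig x u /\ proj1_sig y v /\ congruence T (u ++ v) w).
  destruct x as [C [a Ha]], y as [D [b Hb]]; subst C D; simpl.
  exists (a ++ b).
  apply functional_extensionality; intro w; apply propositional_extensionality.
  split.
  - intros (u & v & Hu & Hv & Hw).
    eapply congruence_trans; [apply congruence_app|]; eassumption.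
  - intro Hw; exists a, b; repeat split; [apply congruence_refl..|exact Hw].
Defined.

Lemma quotient_mul_class {Gamma : Type} (T : semi_thue Gamma) (u v : list Gamma) :
  quotient_mul (class (congruence T) u) (class (congruence T) v)
  = class (congruence T) (u ++ v).
Proof.
  apply subset_eq_compat; simpl.
  apply functional_extensionality; intro w; apply propositional_extensionality.
  split.
  - intros (u' & v' & Hu & Hv & Hw).
    eapply congruence_trans; [apply congruence_app|]; eassumption.
  - intro Hw; exists u, v; repeat split; [apply congruence_refl..|exact Hw].
Qed.

Definition quotient_monoid {Gamma : Type} (T : semi_thue Gamma) : monoid.
Proof.
  refine (@Monoid (quotient (congruence T)) (@quotient_mul _ T)
            (class (congruence T) []) _ _ _).
  - intros x y z.
    destruct (class_surj x) as [u ->], (class_surj y) as [v ->],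
      (class_surj z) as [w ->].
    rewrite !quotient_mul_class, app_assoc; reflexivity.
  - intro x; destruct (class_surj x) as [u ->].
    rewrite quotient_mul_class; reflexivity.
  - intro x; destruct (class_surj x) as [u ->].
    rewrite quotient_mul_class, app_nil_r; reflexivity.
Defined.

Definition eval {Gamma : Type} (T : semi_thue Gamma) (w : list Gamma) :
    quotient_monoid T :=
  class (congruence T) w.

(** * Cyclic words *)

Definition transposed {Gamma : Type} : relation (list Gamma) :=
  fun u v => exists r s, u = r ++ s /\ v = s ++ r.

Lemma transposed_equiv (Gamma : Type) : Equivalence (@transposed Gamma).
Proof.
  split; red.
  - intro u; exists [], u; split; [|rewrite app_nil_r]; reflexivity.
  - intros u v (r & s & -> & ->); exists s, r; auto.
  - intros u v w (r & s & -> & ->) (r' & s' & H & ->).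
    destruct (app_eq_app _ _ _ _ H) as [l [[-> ->]|[-> ->]]].
    + exists (r ++ r'), l; rewrite !app_assoc; auto.
    + exists l, (s' ++ s); rewrite !app_assoc; auto.
Qed.

Definition cyclic_word (Gamma : Type) : Type := quotient (@transposed Gamma).

Definition cyclic {Gamma : Type} (w : list Gamma) : cyclic_word Gamma :=
  class transposed w.

Definition cyclic_step {Gamma : Type} (T : semi_thue Gamma) :
    relation (cyclic_word Gamma) :=
  fun x y => exists u v, cyclic u = x /\ cyclic v = y /\ step T u v.

Definition C_extension {Gamma : Type} (S T : semi_thue Gamma) : Prop :=
  inclusion _ S T
  /\ (forall u v, congruence S u v <-> congruence T u v)
  /\ Confluent _ (cyclic_step T).

Inductive add_inverse_rules {Gamma : Type} (S : semi_thue Gamma)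
    (tilde : Gamma -> list Gamma) : semi_thue Gamma :=
| add_inverse_rules_base l r : S l r -> add_inverse_rules S tilde l r
| add_inverse_rules_right a : add_inverse_rules S tilde [] ([a] ++ tilde a)
| add_inverse_rules_left a : add_inverse_rules S tilde [] (tilde a ++ [a]).

(* Main.v *)
Require Import Defs.
From Stdlib Require Import List Relations Relations_2 Relations_3.
From Stdlib Require Import Relations_2_facts.
Import ListNotations.

(** Conjugation can be simulated by cyclic rewriting.  A word [g] has the formal
    inverse [g'] obtained by reversing [g] and applying [tilde] to each letter,
    and the rules [1 -> a (tilde a)] build [g g'] from the empty word, by
    nested insertions in the middle.  Hence

      [u  =>*  u g g'  ~  g' u g],

    where the last step is a mere rotation.  If [v] is the conjugate of [u] by
    [g], then [g' u g] and [v] are equal in the group, and since [S] is confluent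
    they have a common descendant under [S] ([confluent_congruence_coherent]).
    Its cyclic word is the required [t] ([conjugate_cyclic_coherent]).

    Conversely, cyclic rewriting never leaves a conjugacy class
    ([cyclic_star_conjugate]): the rules of [add_inverse_rules S tilde] hold in
    the group, and [r s] and [s r] are conjugate in any group.

    Confluence on cyclic words follows from these two facts together: two
    descendants of one cyclic word are conjugate to it, so they are conjugate to
    each other, so they have a common descendant. *)

(** * Conjugacy in monoids *)

Lemma conjugate_refl (M : monoid) (x : M) : conjugate x x.
Proof.
  exists one, one; unfold inverse_of.
  rewrite !mul_one_l, mul_one_r; auto.
Qed.

Lemma conjugate_sym (M : monoid) (x y : M) : conjugate x y -> conjugate y x.
Proof.
  intros (g & h & [Hgh Hhg] & <-); exists h, g; split; [split; assumption|].
  rewrite !mul_assoc, Hgh, mul_one_l, <- mul_assoc, Hgh, mul_one_r; reflexivity.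
Qed.

Lemma conjugate_trans (M : monoid) (x y z : M) :
  conjugate x y -> conjugate y z -> conjugate x z.
Proof.
  intros (g & h & [Hgh Hhg] & <-) (k & l & [Hkl Hlk] & <-).
  exists (mul g k), (mul l h); split; [split|].
  - rewrite <- mul_assoc, (mul_assoc _ k), Hkl, mul_one_l; exact Hgh.
  - rewrite <- mul_assoc, (mul_assoc _ h), Hhg, mul_one_l; exact Hlk.
  - rewrite !mul_assoc; reflexivity.
Qed.

Lemma group_mul_conjugate (M : monoid) (x y : M) :
  is_group M -> conjugate (mul x y) (mul y x).
Proof.
  intro HG; destruct (HG x) as [z [Hxz Hzx]].
  exists x, z; split; [split; assumption|].
  rewrite mul_assoc, Hzx, mul_one_l; reflexivity.
Qed.

Lemma left_right_inverse_eq (M : monoid) (x y z : M) :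
  mul x y = one -> mul y z = one -> x = z.
Proof.
  intros Hxy Hyz.
  rewrite <- (mul_one_r _ x), <- Hyz, mul_assoc, Hxy; apply mul_one_l.
Qed.

Lemma group_mul_one_comm (M : monoid) (x y : M) :
  is_group M -> mul x y = one -> mul y x = one.
Proof.
  intros HG Hxy; destruct (HG x) as [z [Hxz Hzx]].
  rewrite <- (left_right_inverse_eq _ _ _ _ Hzx Hxy); exact Hzx.
Qed.

(** * Rewriting and congruence *)

Section Rewriting.

Context {Gamma : Type}.
Implicit Types (T : semi_thue Gamma) (u v w p q : list Gamma).

Lemma eval_eq T u v : eval T u = eval T v <-> congruence T u v.
Proof. apply class_eq, congruence_equiv. Qed.

Lemma eval_app T u v : eval T (u ++ v) = mul (eval T u) (eval T v).
Proof. symmetry; apply quotient_mul_class. Qed.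

Lemma step_context T p q u v : step T u v -> step T (p ++ u ++ q) (p ++ v ++ q).
Proof.
  intros (p' & q' & l & r & Hlr & -> & ->).
  exists (p ++ p'), (q' ++ q), l, r.
  rewrite <- !app_assoc; auto.
Qed.

Lemma step_star_context T p q u v :
  Rstar _ (step T) u v -> Rstar _ (step T) (p ++ u ++ q) (p ++ v ++ q).
Proof.
  induction 1 as [|u w v Huw _ IH]; [apply Rstar_0|].
  eapply Rstar_n; [apply step_context, Huw|exact IH].
Qed.

Lemma step_star_mono T T' u v :
  inclusion _ T T' -> Rstar _ (step T) u v -> Rstar _ (step T') u v.
Proof.
  intro HT; induction 1 as [|u w v (p & q & l & r & Hlr & Hu & Hw) _ IH];
    [apply Rstar_0|].
  apply Rstar_n with w; [exists p, q, l, r; auto|exact IH].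
Qed.

Lemma step_star_app T u u' v v' :
  Rstar _ (step T) u u' -> Rstar _ (step T) v v' ->
  Rstar _ (step T) (u ++ v) (u' ++ v').
Proof.
  intros Hu Hv; apply Rstar_transitive with (u' ++ v).
  - exact (step_star_context T [] v u u' Hu).
  - pose proof (step_star_context T u' [] v v' Hv) as H.
    rewrite !app_nil_r in H; exact H.
Qed.

Lemma step_congruence T u v : step T u v -> congruence T u v.
Proof.
  intros (p & q & l & r & Hlr & -> & ->).
  repeat apply congruence_app;
    auto using congruence_refl, congruence_rule.
Qed.

Lemma congruence_least T T' :
  (forall l r, T l r -> congruence T' l r) ->
  forall u v, congruence T u v -> congruence T' u v.
Proof.
  intros HT u v; induction 1;
    eauto using congruence_refl, congruence_sym, congruence_trans, congruence_app.
Qed.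

(** The Church-Rosser property.  Having a common descendant is a congruence;
    transitivity is where confluence enters, to join the two descendants
    obtained for the middle word. *)
Lemma confluent_congruence_coherent T u v :
  Confluent _ (step T) -> congruence T u v -> coherent _ (step T) u v.
Proof.
  intro HT; induction 1 as
    [l r Hlr|u|u v _ [w [Huw Hvw]]|u v w _ [x [Hux Hvx]] _ [y [Hvy Hwy]]
    |u u' v v' _ [x [Hux Hux']] _ [y [Hvy Hvy']]].
  - exists r; split; [|apply Rstar_0].
    apply Rstar_contains_R; exists [], [], l, r.
    rewrite !app_nil_r; auto.
  - exists u; split; apply Rstar_0.
  - exists w; auto.
  - destruct (HT v x y Hvx Hvy) as [z [Hxz Hyz]].
    exists z; split; eapply Rstar_transitive; eassumption.
  - exists (x ++ y); split; apply step_star_app; assumption.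
Qed.

(** * Cyclic rewriting *)

Lemma cyclic_eq u v : cyclic u = cyclic v <-> transposed u v.
Proof. apply class_eq, transposed_equiv. Qed.

Lemma cyclic_app_comm u v : cyclic (u ++ v) = cyclic (v ++ u).
Proof. apply cyclic_eq; exists u, v; auto. Qed.

Lemma step_star_cyclic T u v :
  Rstar _ (step T) u v -> Rstar _ (cyclic_step T) (cyclic u) (cyclic v).
Proof.
  induction 1 as [|u w v Huw _ IH]; [apply Rstar_0|].
  apply Rstar_n with (cyclic w); [exists u, w; auto|exact IH].
Qed.

Lemma transposed_conjugate T u v :
  is_group (quotient_monoid T) -> transposed u v ->
  conjugate (eval T u) (eval T v).
Proof.
  intros HG (r & s & -> & ->).
  rewrite !eval_app; apply group_mul_conjugate, HG.
Qed.

Lemma cyclic_star_conjugate S T u v :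
  is_group (quotient_monoid S) ->
  (forall u v, congruence T u v -> congruence S u v) ->
  Rstar _ (cyclic_step T) (cyclic u) (cyclic v) ->
  conjugate (eval S u) (eval S v).
Proof.
  intros HG HTS Huv.
  remember (cyclic u) as x eqn:Hx; remember (cyclic v) as y eqn:Hy.
  revert u v Hx Hy; induction Huv as [x|x y z Hxy _ IH]; intros u v Hu Hv.
  - apply transposed_conjugate; [exact HG|apply cyclic_eq; congruence].
  - destruct Hxy as (u' & w & Hu' & Hw & Hstep).
    apply conjugate_trans with (eval S w); [|auto].
    apply conjugate_trans with (eval S u').
    + apply transposed_conjugate; [exact HG|apply cyclic_eq; congruence].
    + rewrite (proj2 (eval_eq S u' w)) by auto using step_congruence.
      apply conjugate_refl.
Qed.

(** * Adjoining inverse rules *)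

Section InverseRules.

Variables (S : semi_thue Gamma) (tilde : Gamma -> list Gamma).
Hypothesis tilde_inverse : forall a, eval S ([a] ++ tilde a) = one.

Lemma congruence_add_inverse_rules :
  is_group (quotient_monoid S) ->
  forall u v, congruence S u v <-> congruence (add_inverse_rules S tilde) u v.
Proof.
  intro HG; split; apply congruence_least.
  - intros l r Hlr; apply congruence_rule, add_inverse_rules_base, Hlr.
  - intros l r [l' r' Hlr|a|a].
    + apply congruence_rule, Hlr.
    + apply eval_eq; symmetry; apply tilde_inverse.
    + apply eval_eq; symmetry; rewrite eval_app.
      apply group_mul_one_comm; [exact HG|].
      rewrite <- eval_app; apply tilde_inverse.
Qed.

Definition formal_inverse (g : list Gamma) : list Gamma := flat_map tilde (rev g).

Lemma formal_inverse_cons a g :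
  formal_inverse (a :: g) = formal_inverse g ++ tilde a.
Proof.
  unfold formal_inverse; simpl.
  rewrite flat_map_app; simpl; rewrite app_nil_r; reflexivity.
Qed.

Lemma step_star_formal_inverse g :
  Rstar _ (step (add_inverse_rules S tilde)) [] (g ++ formal_inverse g).
Proof.
  induction g as [|a g IH]; [apply Rstar_0|].
  apply Rstar_n with ([a] ++ [] ++ tilde a).
  - exists [], [], [], ([a] ++ tilde a).
    rewrite !app_nil_r; split; [apply add_inverse_rules_right|auto].
  - replace ((a :: g) ++ formal_inverse (a :: g))
      with ([a] ++ (g ++ formal_inverse g) ++ tilde a)
      by (rewrite formal_inverse_cons, <- app_assoc; reflexivity).
    apply step_star_context, IH.
Qed.

Lemma eval_formal_inverse g : mul (eval S g) (eval S (formal_inverse g)) = one.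
Proof.
  induction g as [|a g IH]; [apply mul_one_l|].
  change (a :: g) with ([a] ++ g) at 1.
  rewrite formal_inverse_cons, !eval_app.
  rewrite <- mul_assoc, (mul_assoc _ (eval S g)), IH, mul_one_l.
  rewrite <- eval_app; apply tilde_inverse.
Qed.

Lemma conjugate_cyclic_coherent u v :
  Confluent _ (step S) -> conjugate (eval S u) (eval S v) ->
  coherent _ (cyclic_step (add_inverse_rules S tilde)) (cyclic u) (cyclic v).
Proof.
  intros HS (x & y & [_ Hyx] & Hconj).
  destruct (class_surj x) as [g ->]; fold (eval S g) in *.
  (* Inverses are unique, so the inverse [y] of [g] can be represented by
     [formal_inverse g], the word that the inverse rules produce. *)
  rewrite (left_right_inverse_eq _ _ _ _ Hyx (eval_formal_inverse g)),
    <- !eval_app in Hconj.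
  apply eval_eq, (confluent_congruence_coherent _ _ _ HS) in Hconj.
  destruct Hconj as [w [Hguw Hvw]].
  assert (lift : forall s t, Rstar _ (step S) s t ->
    Rstar _ (cyclic_step (add_inverse_rules S tilde)) (cyclic s) (cyclic t)).
  { intros s t Hst; apply step_star_cyclic, step_star_mono with S; [|exact Hst].
    exact (add_inverse_rules_base S tilde). }
  exists (cyclic w); split; [|apply lift, Hvw].
  apply Rstar_transitive with (cyclic (u ++ g ++ formal_inverse g)).
  - apply step_star_cyclic.
    rewrite <- (app_nil_r u) at 1.
    apply step_star_app; [apply Rstar_0|apply step_star_formal_inverse].
  - rewrite app_assoc, cyclic_app_comm, app_assoc; apply lift, Hguw.
Qed.

End InverseRules.

End Rewriting.

Theorem theorem2p4 (Gamma : Type) (S : semi_thue Gamma)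
    (S_confluent : Confluent _ (step S))
    (S_weakly_terminating : weakly_terminating S)
    (G_group : is_group (quotient_monoid S))
    (tilde : Gamma -> list Gamma)
    (tilde_inverse : forall a : Gamma, eval S ([a] ++ tilde a) = one) :
  (forall u v : list Gamma,
     conjugate (eval S u) (eval S v) <->
     exists t : cyclic_word Gamma,
       Rstar _ (cyclic_step (add_inverse_rules S tilde)) (cyclic u) t /\
       Rstar _ (cyclic_step (add_inverse_rules S tilde)) (cyclic v) t)
  /\ C_extension S (add_inverse_rules S tilde).
Proof.
  pose proof (congruence_add_inverse_rules S tilde tilde_inverse G_group) as Hcongr.
  assert (star_conjugate : forall u v,
    Rstar _ (cyclic_step (add_inverse_rules S tilde)) (cyclic u) (cyclic v) ->
    conjugate (eval S u) (eval S v)).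
  { intros u v; apply cyclic_star_conjugate; [exact G_group|apply Hcongr]. }
  split; [|split; [|split]].
  - intros u v; split.
    + apply conjugate_cyclic_coherent; assumption.
    + intros (t & Hu & Hv); destruct (class_surj t) as [w ->].
      apply conjugate_trans with (eval S w); [|apply conjugate_sym];
        apply star_conjugate; assumption.
  - exact (add_inverse_rules_base S tilde).
  - exact Hcongr.
  - intros x y z Hxy Hxz.
    destruct (class_surj x) as [u ->], (class_surj y) as [v ->],
      (class_surj z) as [w ->].
    apply conjugate_cyclic_coherent; [assumption..|].
    apply conjugate_trans with (eval S u); [apply conjugate_sym|];
      apply star_conjugate; assumption.
Qed.
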